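(* Let $\mathcal{H}$ be a (complex) Hilbert space with inner product $(\cdot,\cdot)$ and norm $\|\cdot\|$, and let $\{\phi_n\}_{n=1}^{\infty}$ be a sequence in $\mathcal{H}$. Put $a_{m,n}=(\phi_m,\phi_n)$ for $m,n\in\mathbb{N}$, and assume that $$C=\sup_{m\in\mathbb{N}}\sum_{n=1}^{\infty}|a_{m,n}|=\sup_{n\in\mathbb{N}}\sum_{m=1}^{\infty}|a_{m,n}|<\infty .$$ If $f\in\mathcal{H}$, then $$\sum_{n=1}^{\infty}|(f,\phi_n)|^{2}\le C\,\|f\|^{2}.$$
   Context: $\mathbb{N}=\{1,2,3,\dots\}$. The inner product $(\cdot,\cdot)$ is linear in the first variable and conjugate-linear in the second. *)

(* Defs.v *)
From HB Require Import structures.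
From mathcomp Require Import all_boot all_order all_algebra sesquilinear.
From mathcomp Require Import complex.
From mathcomp Require Import all_classical all_reals all_analysis.

Set Implicit Arguments.
Unset Strict Implicit.
Unset Printing Implicit Defensive.

Import Order.TTheory GRing.Theory Num.Theory.
Import numFieldNormedType.Exports.

Local Open Scope classical_set_scope.
Local Open Scope ring_scope.

(* The norm of a space over R[i], and the modulus of R[i] itself, take their
   values in R[i]; they are nonnegative there, hence have imaginary part 0, so
   taking the real part only moves them to R. *)
Definition rnorm (R : realType) (V : normedZmodType R[i]) (x : V) : R :=
  complex.Re `|x|.

(* A Hilbert space over R[i] is a complete normed module H with a positive
   definite Hermitian form that induces its norm. [{dot H for Num.conj}] is
   linear in its first argument and conjugate-linear in the second. *)
Definition induces_norm (R : realType) (H : completeNormedModType R[i])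
  (inner : {dot H for @Num.conj R[i]}) : Prop :=
  forall x : H, `|x| ^+ 2 = inner x x.

(* Sequences and double sequences are indexed by nat, of which only the indices
   1, 2, 3, ... are used; the entries with an index 0 play no role. *)
Definition gram (R : realType) (H : completeNormedModType R[i])
  (inner : {dot H for @Num.conj R[i]}) (phi : nat -> H) (m n : nat) : R[i] :=
  inner (phi m) (phi n).

Definition sup_row_sums (R : realType) (a : nat -> nat -> R[i]) : \bar R :=
  ereal_sup [set (\sum_(1 <= n <oo) (rnorm (a m n))%:E)%E
            | m in [set m | (1 <= m)%N]].

Definition sup_col_sums (R : realType) (a : nat -> nat -> R[i]) : \bar R :=
  ereal_sup [set (\sum_(1 <= m <oo) (rnorm (a m n))%:E)%E
            | n in [set n | (1 <= n)%N]].

(* Main.v *)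
Require Import Defs.
From HB Require Import structures.
From mathcomp Require Import all_boot all_order all_algebra sesquilinear.
From mathcomp Require Import complex.
From mathcomp Require Import all_classical all_reals all_analysis.
From mathcomp Require Import ring.
Import Order.TTheory GRing.Theory Num.Theory.
Import numFieldNormedType.Exports.
Local Open Scope classical_set_scope.
Local Open Scope ring_scope.

(** The finite partial sums are bounded by duality. Write c_n = (f, phi_n),
    g = sum_n c_n phi_n and S = sum_n |c_n|^2, all over a finite range of
    indices. Then (f, g) = S, while ||g||^2 is the Gram quadratic form at c,
    which is at most C S since each row and each column of the moduli |a_mn|
    sums to at most C ([schur_test]). Expanding

      0 <= ||C f - g||^2 = C^2 ||f||^2 - 2 C S + ||g||^2
                        <= C (C ||f||^2 - S)

    gives S <= C ||f||^2 when C > 0; when C = 0 the bound on ||g||^2 forces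
    g = 0, hence S = (f, g) = 0 ([finite_bessel]). The partial sums of a row of
    moduli are bounded by the supremum C ([sup_row_sums_ge]), so the finite
    estimate applies to every partial sum and passes to the limit. *)

(** Schur's test in its quadratic form: 2 x_i x_j <= x_i^2 + x_j^2 splits the
    double sum into one half controlled by the row sums and one half controlled
    by the column sums. *)
Lemma schur_test (K : numFieldType) (I : eqType) (r : seq I)
    (b : I -> I -> K) (x : I -> K) (M : K) :
    (forall i j, 0 <= b i j) -> (forall i, 0 <= x i) ->
    (forall i, i \in r -> \sum_(j <- r) b i j <= M) ->
    (forall j, j \in r -> \sum_(i <- r) b i j <= M) ->
  \sum_(i <- r) \sum_(j <- r) x i * x j * b i j <= M * \sum_(i <- r) x i ^+ 2.
Proof.
move=> b0 x0 rows cols.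
rewrite -(ler_pM2r (ltr0Sn K 1)).
have amgm i j : x i * x j * b i j * 2 <= x i ^+ 2 * b i j + x j ^+ 2 * b i j.
  rewrite -subr_ge0.
  rewrite [leRHS](_ : _ = (x i - x j) ^+ 2 * b i j); last by ring.
  by rewrite mulr_ge0// real_exprn_even_ge0// rpredB// ger0_real.
apply: (@le_trans _ _ (\sum_(i <- r) \sum_(j <- r)
    (x i ^+ 2 * b i j + x j ^+ 2 * b i j))).
  rewrite mulr_suml; apply: ler_sum => i _.
  by rewrite mulr_suml; apply: ler_sum => j _.
under eq_bigr do rewrite big_split/=.
rewrite big_split/= [X in _ + X]exchange_big/= mulr_natr mulr2n mulr_sumr.
apply: lerD; rewrite big_seq [leRHS]big_seq; apply: ler_sum => i ir;
  rewrite -mulr_sumr mulrC ler_wpM2r ?exprn_ge0 ?rows ?cols//.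
Qed.

(** Bessel's inequality with the orthonormality of the family replaced by a
    bound on the absolute row sums of its Gram matrix. Rows suffice: the matrix
    is Hermitian, so its column sums of moduli are the same. Positivity of
    M f - g is used instead of the Cauchy-Schwarz inequality, so nothing is
    assumed on the dimension of the space. *)
Lemma finite_bessel (K : numClosedFieldType) (U : lmodType K)
    (form : {dot U for @Num.conj K}) (I : eqType) (r : seq I)
    (phi : I -> U) (M : K) (f : U) :
    0 <= M ->
    (forall i, i \in r -> \sum_(j <- r) `|form (phi i) (phi j)| <= M) ->
  \sum_(i <- r) `|form f (phi i)| ^+ 2 <= M * form f f.
Proof.
move=> M0 rows.
have hC u v : form u v = (form v u)^* by rewrite hermC mul1r.
pose c i := form f (phi i).
pose g := \sum_(i <- r) c i *: phi i.
set S := \sum_(i <- r) _.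
have S0 : 0 <= S by apply: sumr_ge0 => i _; rewrite exprn_ge0.
have fg : form f g = S.
  rewrite /g linear_sumr; apply: eq_bigr => i _.
  by rewrite linearZr_LR/= normCKC.
have gg : form g g <= M * S.
  have gg_ge0 : 0 <= form g g by exact: dnorm_ge0.
  rewrite -(ger0_norm gg_ge0).
  apply: (@le_trans _ _ (\sum_(i <- r) \sum_(j <- r)
      `|c i| * `|c j| * `|form (phi i) (phi j)|)).
    rewrite {1}/g linear_sumlz/=; apply: (le_trans (ler_norm_sum _ _ _)).
    apply: ler_sum => i _.
    rewrite linearZl_LR/= normrM /g linear_sumr/=.
    under [leRHS]eq_bigr do rewrite -mulrA.
    rewrite -mulr_sumr ler_wpM2l//; apply: (le_trans (ler_norm_sum _ _ _)).
    by apply: ler_sum => j _; rewrite linearZr_LR/= normrM norm_conjC.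
  apply: schur_test => // j jr; under eq_bigr do rewrite hC norm_conjC.
  exact: rows.
(* For M = 0 the vector M f - g carries no information on f; there g = 0. *)
move: M0; rewrite le_eqVlt => /predU1P[M0|M0].
  have g0 : g = 0.
    apply/eqP; rewrite -(dnorm_eq0 form) eq_le dnorm_ge0 andbT.
    by move: gg; rewrite -M0 mul0r.
  by rewrite -M0 mul0r -fg g0 linear0r.
rewrite -(ler_pM2l M0) -subr_ge0.
have := dnorm_ge0 form (M *: f - g).
rewrite dnormB dnormZ (linearZl_LR form)/= fg.
rewrite (geC0_conj (mulr_ge0 (ltW M0) S0)) (ger0_norm (ltW M0)) => /le_trans; apply.
rewrite -subr_ge0 [leRHS](_ : _ = M * S - form g g); last by ring.
by rewrite subr_ge0.
Qed.

Lemma rnormE (R : realType) (V : normedZmodType R[i]) (x : V) :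
  (rnorm x)%:C%C = `|x|.
Proof. by rewrite /rnorm RRe_real ?normr_real. Qed.

Lemma rnorm_ge0 (R : realType) (V : normedZmodType R[i]) (x : V) :
  0 <= rnorm x.
Proof. by rewrite -ler0c rnormE. Qed.

Lemma sup_row_sums_ge (R : realType) (a : nat -> nat -> R[i]) (m N : nat) :
  (1 <= m)%N -> ((\sum_(1 <= n < N) rnorm (a m n))%:E <= sup_row_sums a)%E.
Proof.
move=> m1; apply: (@le_trans _ _ (\sum_(1 <= n <oo) (rnorm (a m n))%:E)%E).
  rewrite -sumEFin; apply: nneseries_lim_ge => n _ _.
  by rewrite lee_fin rnorm_ge0.
by apply: ereal_sup_ubound; exists m.
Qed.

Theorem theorem2 (R : realType) (H : completeNormedModType R[i])
    (inner : {dot H for @Num.conj R[i]}) (inner_norm : induces_norm inner)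
    (phi : nat -> H) (C : R)
    (C_rows : C%:E = sup_row_sums (gram inner phi))
    (C_cols : C%:E = sup_col_sums (gram inner phi))
    (f : H) :
  (\sum_(1 <= n <oo) (rnorm (inner f (phi n)) ^+ 2)%:E
     <= (C * rnorm f ^+ 2)%:E)%E.
Proof.
have row_le m N : (1 <= m)%N ->
    \sum_(1 <= n < N) rnorm (gram inner phi m n) <= C.
  by move=> m1; rewrite -lee_fin C_rows sup_row_sums_ge.
(* The empty partial sum of row 1 bounds C from below by 0. *)
have C0 : 0 <= C by have := row_le 1 1 isT; rewrite big_geq.
apply: lime_le.
  by apply: is_cvg_nneseries => n _ _; rewrite lee_fin exprn_ge0 ?rnorm_ge0.
(* The finite estimate lives in the complex field, where the inner product takes
   its values; the embedding of the reals carries the bounds there and back. *)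
apply: nearW => N; rewrite sumEFin lee_fin -lecR.
rewrite rmorphM rmorph_sum rmorphXn/= rnormE inner_norm.
under eq_bigr do rewrite rmorphXn/= rnormE.
apply: finite_bessel; first by rewrite ler0c.
move=> m; rewrite mem_index_iota => /andP[m1 _].
under eq_bigr do rewrite -rnormE.
by rewrite -rmorph_sum lecR; exact: row_le.
Qed.
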